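(* For every positive integer $r$ there exist $\delta=\delta(r)>0$ and $n_0=n_0(r)$ with the following property: if $A$ and $B$ are sets of real numbers with $|A|=|B|=n\ge n_0$ and $|A+B|\le n^{1+\delta}$, then any $r$-coloring of $A\times B$ contains a monochromatic corner, i.e. three points of the form $(a,b),(a+d,b),(a,b+d)$ with $d>0$. Moreover, one can choose $\delta=\frac{1}{2^{r+1}}$ (with a suitable $n_0(r)$).
   Context: $A+B=\{a+b: a\in A, b\in B\}$. *)

(* Defs.v *)
From mathcomp Require Import all_boot all_order all_algebra finmap.
From mathcomp Require Import all_classical all_reals all_analysis.

Set Implicit Arguments.
Unset Strict Implicit.
Unset Printing Implicit Defensive.

Import Order.TTheory GRing.Theory Num.Theory.
Local Open Scope fset_scope.
Local Open Scope ring_scope.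

Definition sumset (R : realType) (A B : {fset R}) : {fset R} :=
  [fset a + b | a in A, b in B].

(* Only d > 0 is allowed: corners have the right angle at the lower left. *)
Definition corner (R : realType) (p q s : R * R) : Prop :=
  exists a b d : R,
    [/\ 0 < d, p = (a, b), q = (a + d, b) & s = (a, b + d)].

(* A coloring is a function on the finite type of the elements of A `*` B, so
   the three points x, y, z of the corner lie in A `*` B. *)
Definition has_monochromatic_corner (R : realType) (r : nat) (A B : {fset R})
    (c : (A `*` B)%fset -> 'I_r) : Prop :=
  exists x y z : (A `*` B)%fset,
    corner (val x) (val y) (val z) /\ c x = c y /\ c x = c z.

Definition forces_corners (R : realType) (r : nat) (delta : R) (n0 : nat)
    : Prop :=
  forall (n : nat) (A B : {fset R}),
    (n0 <= n)%N -> #|` A| = n -> #|` B| = n ->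
    #|` sumset A B|%:R <= n%:R `^ (1 + delta) ->
    forall c : (A `*` B)%fset -> 'I_r, has_monochromatic_corner c.

(* Main.v *)
(** Two points p, q of the same colour on an antidiagonal, p to the left of q,
    forbid their colour at the apex (p.1, q.2), since apex, q, p form a corner.
    A set L of k points on an antidiagonal has k (k - 1) / 2 distinct apexes;
    by pigeonhole some k^2 / (4 r |A+B|) of them share both their
    antidiagonal and their colour.  The apexes of these are again apexes of L,
    so they avoid the colours already forbidden to the apexes of L as well as
    the new colour.  Starting from a richest antidiagonal of A x B, with at
    least n^2 / |A+B| points, after r steps every colour is forbidden, while two
    points are still left and hence an apex. *)

Require Import Defs.
From mathcomp Require Import all_boot all_order all_algebra finmap.
From mathcomp Require Import all_classical all_reals all_analysis.
From mathcomp Require Import zify.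
Import Order.TTheory GRing.Theory Num.Theory.
Local Open Scope ring_scope.

Set Implicit Arguments.
Unset Strict Implicit.
Unset Printing Implicit Defensive.

Lemma card_pigeonhole (T U : finType) (h : T -> U) (D : {set T}) :
  (0 < #|D|)%N ->
  exists u, (#|D| <= #|U| * #|[set x in D | h x == u]|)%N.
Proof.
case/card_gt0P => x0 _.
have /card_gt0P U_gt0 : exists u, u \in U by exists (h x0).
have [u max_u] := @bigop.eq_bigmax U (fun u => #|[set x in D | h x == u]|) U_gt0.
exists u; rewrite -sum1_card (partition_big h predT) //=.
rewrite -sum_nat_const; apply: leq_sum => v _.
rewrite sum1dep_card -max_u.
exact: (bigop.leq_bigmax (F := fun u => #|[set x in D | h x == u]|)).
Qed.

(** [L] times [L] is the disjoint union of the diagonal, the set [E] of increasing pairs and its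
    mirror image under [swap]; injectivity of [f] leaves no ties off the diagonal. *)
Lemma card_lt_pairs {disp} {O : orderType disp} (T : finType) (f : T -> O)
    (L : {set T}) :
  {in L &, injective f} ->
  (#|L| * #|L|.-1 = 2 * #|[set e in finset.setX L L | (f e.1 < f e.2)%O]|)%N.
Proof.
move=> f_inj; set E := [set e in _ | _].
pose swap (e : T * T) := (e.2, e.1).
have swapK : involutive swap by case.
have cLL : (#|L| + (#|E| + #|swap @: E|) = #|L| * #|L|)%N.
  rewrite -[RHS]cardsX -[in LHS](card_in_imset (f := fun x => (x, x)) (D := L));
    last by move=> x y _ _ [].
  rewrite -cardsUI [X in (_ + (_ + X))%N](_ : _ = 0%N); last first.
    apply/eqP; rewrite cards_eq0; apply/eqP/setP => -[x y].
    rewrite !inE /=; apply/negP => /andP[/andP[_ lt_xy]].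
    case/imsetP => -[u v]; rewrite !inE /= => /andP[_ lt_uv] [xv yu].
    by move: lt_uv; rewrite -xv -yu (lt_gtF lt_xy).
  rewrite addn0 -cardsUI [X in (_ + X)%N](_ : _ = 0%N); last first.
    apply/eqP; rewrite cards_eq0; apply/eqP/setP => -[x y].
    rewrite !inE; apply/negP => /andP[/imsetP[z _ [-> ->]]] /orP[|].
      by rewrite ltxx andbF.
    by case/imsetP => -[u v]; rewrite !inE /= => /andP[_ lt_uv] [zv zu];
      move: lt_uv; rewrite -zv -zu ltxx.
  rewrite addn0; apply: eq_card => -[x y]; rewrite !inE /=.
  apply/idP/idP.
    case/or3P => [/imsetP[z zL [-> ->]]|/andP[]//|]; first by rewrite zL.
    by case/imsetP => -[u v]; rewrite !inE /= => /andP[/andP[uL vL] _] [-> ->];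
      rewrite uL vL.
  case/andP => xL yL; rewrite xL yL /=.
  case: (ltgtP (f x) (f y)) => [//|lt_yx|eq_xy]; first by rewrite orbT.
    apply/or3P/Or33/imsetP; exists (y, x) => //.
    by rewrite !inE /= xL yL.
  apply/orP; left; apply/imsetP; exists x => //.
  by rewrite [in RHS](f_inj _ _ xL yL eq_xy) (f_inj _ _ xL yL eq_xy).
rewrite (card_imset _ (inv_inj swapK)) in cLL.
by nia.
Qed.

Section AntidiagonalStep.

(** Finite types stand for the sets so that counting is plain cardinality; [f] and [g] read off the
    numbers, and [s] labels antidiagonals by elements of [S]. *)
Variables (R : realDomainType) (X Y S C : finType).
Variables (f : X -> R) (g : Y -> R) (s : X * Y -> S) (c : X * Y -> C).
Hypotheses (f_inj : injective f) (g_inj : injective g).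
Hypothesis s_sum :
  forall p q, s p = s q -> f p.1 + g p.2 = f q.1 + g q.2.
Hypothesis no_corner : forall x x' y y',
  f x < f x' -> f x' + g y = f x + g y' ->
  ~ (c (x, y) = c (x', y) /\ c (x, y) = c (x, y')).

Definition on_antidiagonal (L : {set X * Y}) := {in L &, forall p q, s p = s q}.

Definition apexes_avoid (L : {set X * Y}) (F : {set C}) :=
  {in L &, forall p q, f p.1 < f q.1 -> c (p.1, q.2) \notin F}.

Lemma antidiagonal_fst_inj (L : {set X * Y}) :
  on_antidiagonal L -> {in L &, injective fst}.
Proof.
move=> sL [x y] [x' y'] pL qL /= eqx; subst x'.
by have /= /addrI/g_inj -> := s_sum (sL _ _ pL qL).
Qed.

Lemma antidiagonal_snd_inj (L : {set X * Y}) :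
  on_antidiagonal L -> {in L &, injective snd}.
Proof.
move=> sL [x y] [x' y'] pL qL /= eqy; subst y'.
by have /= /addIr/f_inj -> := s_sum (sL _ _ pL qL).
Qed.

Lemma antidiagonal_step (L : {set X * Y}) (F : {set C}) :
  on_antidiagonal L -> apexes_avoid L F -> (1 < #|L|)%N ->
  exists (L' : {set X * Y}) (k : C),
    [/\ k \notin F, on_antidiagonal L', apexes_avoid L' (k |: F)
      & (#|L| ^ 2 <= 4 * #|C| * #|S| * #|L'|)%N].
Proof.
move=> sL avL L_gt1.
pose E := [set e in finset.setX L L | f e.1.1 < f e.2.1].
pose apex (e : (X * Y) * (X * Y)) := (e.1.1, e.2.2).
have fstL := antidiagonal_fst_inj sL.
have cE : (#|L| * #|L|.-1 = 2 * #|E|)%N.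
  apply: (card_lt_pairs (f := fun p : X * Y => f p.1)).
  by move=> p q pL qL /f_inj; apply: fstL.
(* On an antidiagonal either coordinate determines the point, so an apex recovers both points of its
   pair. *)
have apex_inj : {in E &, injective apex}.
  move=> [p q] [p' q']; rewrite !inE /= => /andP[/andP[pL qL] _].
  move=> /andP[/andP[p'L q'L] _] [e1 e2].
  by rewrite (fstL _ _ pL p'L e1) (antidiagonal_snd_inj sL qL q'L e2).
have E_gt0 : (0 < #|apex @: E|)%N by rewrite card_in_imset // -(ltn_pmul2l (isT : 0 < 2)%N) -cE muln_gt0; lia.
have [[u k] cL'] := card_pigeonhole (fun p => (s p, c p)) E_gt0.
set L' := [set p in _ | _] in cL'; rewrite card_prod card_in_imset // in cL'.
rewrite card_in_imset // in E_gt0.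
have L'P p : p \in L' -> [/\ s p = u, c p = k & exists p1 p2,
    [/\ p1 \in L, p2 \in L, f p1.1 < f p2.1 & p = (p1.1, p2.2)]].
  rewrite inE => /andP[/imsetP[[p1 p2]]]; rewrite !inE /=.
  move=> /andP[/andP[p1L p2L] lt12] pE /eqP[sp cp].
  by split=> //; exists p1, p2.
exists L', k; split.
(* Any point of [L'] is an apex of [L] and has colour [k], so [k] was not yet forbidden. *)
- have /card_gt0P[p /L'P[_ <- [p1 [p2 [p1L p2L lt12 ->]]]]] : (0 < #|L'|)%N.
    by rewrite lt0n; apply/eqP => L'0; move: cL'; rewrite L'0 muln0; lia.
  exact: avL.
- by move=> p q /L'P[-> _ _] /L'P[-> _ _].
- move=> p q pL' qL' lt_pq.
  have [sp cp [p1 [p2 [p1L p2L lt12 eqp]]]] := L'P _ pL'.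
  have [sq cq [q1 [q2 [q1L q2L ltq12 eqq]]]] := L'P _ qL'.
  rewrite !inE negb_or; apply/andP; split.
    (* The corner has apex [(p.1, q.2)], right end [q] and upper end [p]; all three would have
       colour [k]. *)
    apply/eqP => capex; apply: (no_corner (y := q.2) (y' := p.2) lt_pq).
      by apply/esym/s_sum; rewrite sp sq.
    by rewrite -!surjective_pairing capex cp cq.
  (* The apex of [p] and [q] is that of [p1] and [q2], because [p1.1 = p.1], [q2.2 = q.2], and [q1]
     lies left of [q2]. *)
  rewrite eqp eqq /=; apply: avL => //.
  by apply: lt_trans ltq12; move: lt_pq; rewrite eqp eqq.
- rewrite (_ : 4 * #|C| * #|S| * #|L'| = 4 * (#|S| * #|C| * #|L'|))%N; last lia.
  (* The factor 4 comes from [4 * #|E| = 2 * #|L| * #|L|.-1], which is at least [#|L| ^ 2] once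
     [#|L|] is at least 2. *)
  apply: (@leq_trans (4 * #|E|)); last by rewrite leq_mul2l.
  rewrite (_ : 4 * #|E| = 2 * (#|L| * #|L|.-1))%N; last by rewrite cE mulnA.
  by rewrite -mulnn mulnCA leq_mul2l; apply/orP; right; lia.
Qed.

(** Induction on the bound [m] for the number of colours still allowed. A step gives
    [#|L| ^ 2 <= K * #|L'|]; raised to the power [2 ^ m], it adds [2 ^ m] to the exponent of [K],
    from [(2 ^ m).-1] to [(2 ^ m.+1).-1]. The factor 2 is the base case: with no colour left, [L]
    has fewer than two points. *)
Lemma antidiagonal_bound (m : nat) (L : {set X * Y}) (F : {set C}) :
  on_antidiagonal L -> apexes_avoid L F -> (#|~: F| <= m)%N ->
  (0 < #|C| * #|S|)%N ->
  (#|L| ^ (2 ^ m) < 2 * (4 * #|C| * #|S|) ^ (2 ^ m).-1)%N.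
Proof.
move=> + + + CS_gt0; set K := (4 * _ * _)%N.
have K_gt0 : (0 < K)%N by rewrite /K -mulnA muln_gt0.
elim: m L F => [|m IHm] L F sL avL cF; rewrite ltnNge; apply/negP => le_KL.
  move: le_KL; rewrite expn0 expn1 /= expn0 muln1 => L_gt1.
  have /card_gt1P[p [q [pL qL /eqP neq_pq]]] := L_gt1.
  have FT k : k \in F.
    by move: cF; rewrite leqn0 cards_eq0 => /eqP/setP/(_ k); rewrite !inE => /negbFE.
  case: (ltgtP (f p.1) (f q.1)) => [lt_pq|lt_qp|/f_inj eq_pq].
  - by have := avL _ _ pL qL lt_pq; rewrite FT.
  - by have := avL _ _ qL pL lt_qp; rewrite FT.
  - exact: neq_pq (antidiagonal_fst_inj sL pL qL eq_pq).
have L_gt1 : (1 < #|L|)%N.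
  rewrite ltnNge; apply/negP => L_le1; move: le_KL; apply/negP; rewrite -ltnNge.
  apply: (@leq_ltn_trans (1 ^ (2 ^ m.+1))); first by rewrite leq_exp2r ?expn_gt0.
  have : (0 < K ^ (2 ^ m.+1).-1)%N by rewrite expn_gt0 K_gt0.
  by rewrite exp1n; lia.
have [L' [k [kF sL' avL' cL']]] := antidiagonal_step sL avL L_gt1.
have cF' : (#|~: (k |: F)| <= m)%N.
  have := cardsC F; have := cardsC (k |: F); rewrite cardsU1 kF; lia.
have := IHm _ _ sL' avL' cF'; rewrite ltnNge => /negP; apply.
rewrite -(leq_pmul2l (m := K ^ (2 ^ m))) ?expn_gt0 ?K_gt0 // -expnMn.
have : (#|L| ^ (2 ^ m.+1) <= (K * #|L'|) ^ (2 ^ m))%N.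
  by rewrite expnS expnM leq_exp2r ?expn_gt0.
apply: leq_trans; apply: leq_trans le_KL.
rewrite mulnCA -expnD leq_mul2l /= leq_pexp2l // expnS.
have : (0 < 2 ^ m)%N by rewrite expn_gt0.
lia.
Qed.

Lemma corner_free_bound :
  (0 < #|X| * #|Y|)%N ->
  ((#|X| * #|Y|) ^ (2 ^ #|C|)
     < 2 * (4 * #|C|) ^ (2 ^ #|C|).-1 * #|S| ^ (2 ^ #|C|.+1).-1)%N.
Proof.
rewrite -card_prod -(finset.cardsT (X * Y)%type) => XY_gt0.
have [u] := card_pigeonhole s XY_gt0; set L := [set p in _ | _] => cL.
have /card_gt0P[p0 _] := XY_gt0.
have C_gt0 : (0 < #|C|)%N by apply/card_gt0P; exists (c p0).
have S_gt0 : (0 < #|S|)%N by apply/card_gt0P; exists u.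
have sL : on_antidiagonal L.
  by move=> p q; rewrite !inE /= => /eqP -> /eqP ->.
have avL : apexes_avoid L finset.set0 by move=> p q _ _ _; rewrite inE.
have := antidiagonal_bound (m := #|C|) sL avL.
rewrite finset.setC0 finset.cardsT leqnn muln_gt0 C_gt0 S_gt0 => /(_ isT isT) ltL.
apply: (@leq_ltn_trans ((#|S| * #|L|) ^ (2 ^ #|C|))).
  by rewrite leq_exp2r ?expn_gt0.
rewrite expnMn; apply: (@leq_trans (#|S| ^ (2 ^ #|C|) *
    (2 * (4 * #|C| * #|S|) ^ (2 ^ #|C|).-1))%N).
  by rewrite ltn_pmul2l ?expn_gt0 ?S_gt0.
(* The powers of [#|S|] from choosing [L] and from the iteration combine: [N + N.-1 = (2 * N).-1]
   with [N = 2 ^ #|C|]. *)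
rewrite [((_ * #|S|) ^ _)%N]expnMn mulnCA [X in (2 * X)%N]mulnCA mulnA -expnD.
rewrite leq_mul2l expnS; apply/orP; right.
have : (0 < 2 ^ #|C|)%N by rewrite expn_gt0.
by set N := (2 ^ _)%N => N_gt0; rewrite (_ : (N + N.-1 = (2 * N).-1)%N) //; lia.
Qed.

End AntidiagonalStep.

(** Raising to the power [q] clears the fractional exponent, so the rest is arithmetic in natural
    numbers. *)
Lemma powR_nat_bound (R : realType) (M n q : nat) :
  (0 < q)%N -> (0 < n)%N ->
  M%:R <= n%:R `^ (1 + 1 / q%:R) :> R -> (M ^ q <= n ^ q.+1)%N.
Proof.
move=> q_gt0 n_gt0 leM; rewrite -(ler_nat R) !natrX.
have q0 : q%:R != 0 :> R by rewrite pnatr_eq0 -lt0n.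
rewrite -(powR_mulrn q.+1) // (_ : q.+1%:R = (1 + 1 / q%:R) * q%:R :> R).
  by rewrite powRrM powR_mulrn ?powR_ge0 // lerXn2r ?nnegrE ?powR_ge0.
by rewrite mulrDl mul1r mul1r mulVf // -natr1.
Qed.

Lemma forces_corners_half_pow (R : realType) (r : nat) :
  exists n0 : nat, forces_corners r (1 / 2 ^+ r.+1 : R) n0.
Proof.
set Q := (2 ^ r.+1)%N; set K := (2 * (4 * r) ^ (2 ^ r).-1)%N.
have Q_gt1 : (1 < Q)%N by rewrite -(expn0 2) ltn_exp2l.
have Q_gt0 := ltnW Q_gt1.
(* With [M] the size of the sumset, having no corner gives [n ^ Q < K * M ^ Q.-1]. Its [Q]-th power
   and [M ^ Q <= n ^ Q.+1] yield [n ^ (Q * Q) < K ^ Q * n ^ (Q * Q - 1)], that is [n < K ^ Q]. *)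
exists (K ^ Q).+1 => n A B le_n cA cB leM c; apply: contrapT => no_corner.
have n_gt0 : (0 < n)%N by apply: leq_trans le_n.
have in_AB (p : A * B) : (val p.1, val p.2) \in (A `*` B)%fset.
  by rewrite in_fsetM !fsvalP.
have in_sum (p : A * B) : val p.1 + val p.2 \in sumset A B.
  by apply/imfset2P; exists (val p.1); rewrite ?fsvalP //; exists (val p.2);
     rewrite ?fsvalP.
have := @corner_free_bound R A B (sumset A B) 'I_r val val
  (fun p => [` in_sum p]%fset) (fun p => c [` in_AB p]%fset) val_inj val_inj.
rewrite -!cardfE cA cB card_ord muln_gt0 n_gt0 -/K => bound.
have {bound} : ((n * n) ^ (2 ^ r) < K * #|` sumset A B| ^ Q.-1)%N.
  apply: bound => // [p q /(congr1 val) //|x x' y y' lt_xx' eq_sum [c1 c2]].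
  apply: no_corner; exists [` in_AB (x, y)]%fset, [` in_AB (x', y)]%fset,
    [` in_AB (x, y')]%fset; split=> //.
  (* [eq_sum] makes the vertical side equal to the horizontal one, [val x' - val x]. *)
  exists (val x), (val y), (val x' - val x); split; rewrite ?subr_gt0 //=.
    by rewrite addrC subrK.
  by rewrite addrA [_ + val x']addrC eq_sum addrAC subrr add0r.
apply/negP; rewrite -leqNgt mulnn -expnM -expnS -/Q.
have := @powR_nat_bound R #|` sumset A B| n Q Q_gt0 n_gt0.
rewrite natrX => /(_ leM) leMQ.
rewrite -(leq_exp2r _ _ Q_gt0) expnMn -expnM [(Q.-1 * Q)%N]mulnC expnM.
apply: (@leq_trans (n * (n ^ Q.+1) ^ Q.-1)).
  by apply: leq_mul; [exact: ltnW | rewrite leq_exp2r //; lia].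
rewrite -!expnM -expnS leq_pexp2l //; nia.
Qed.

Theorem theorem3 (R : realType) (r : nat) (hr : (0 < r)%N) :
  (exists (delta : R) (n0 : nat), 0 < delta /\ forces_corners r delta n0) /\
  (exists n0 : nat, forces_corners r (1 / 2 ^+ r.+1 : R) n0).
Proof.
have [n0 Hn0] := forces_corners_half_pow R r.
split; last by exists n0.
by exists (1 / 2 ^+ r.+1), n0; rewrite divr_gt0 ?exprn_gt0.
Qed.
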